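(* For $n\ge1$ and $m\in\{1,2\}$, writing $f|_{r^is^j}$ for the coefficient of $r^is^j$ in the power series expansion of $f(r,s)$, $$T^{(1)}_4(\mathcal A_n;\tau)=\det_{0\le i,j\le n-1}\begin{pmatrix}\left.\left(\frac{1}{1-rs}+\frac{2r}{(1-r)(1-r-s-rs)}\right)\right|_{r^is^j} & j\le n-2\\[2pt] \left.\left(\frac{1}{1-rs}+\frac{2\tau r}{(1-\tau r)(1-r-s-rs)}\right)\right|_{r^is^j} & j=n-1\end{pmatrix}$$ $$=\det_{0\le i,j\le n-1}\left(\left.\left(\frac{1}{1-rs}+\frac{2r}{(1-r)(1-r-s-rs)}+s^{n-1}r\left\{\frac{2\tau}{1-\tau r}-\frac{2}{1-r}\right\}\frac{(1+r)^{n-1}}{(1-r)^n}\right)\right|_{r^is^j}\right),$$ and $$T^{(2)}_4(\mathcal A_n;\tau)=\det_{0\le i,j\le n-1}\begin{pmatrix}\left.\left(\frac{1}{1-rs}+\frac{2r}{(1-r)(1-r-s-rs)}\right)\right|_{r^is^j} & j\le n-2\\[2pt] \left.\left(\frac{1}{1-rs}+\frac{(1+\tau) r}{(1-\tau r)(1-r-s-rs)}\right)\right|_{r^is^j} & j=n-1\end{pmatrix}$$ $$=\det_{0\le i,j\le n-1}\left(\left.\left(\frac{1}{1-rs}+\frac{2r}{(1-r)(1-r-s-rs)}+s^{n-1}r\left\{\frac{1+\tau}{1-\tau r}-\frac{2}{1-r}\right\}\frac{(1+r)^{n-1}}{(1-r)^n}\right)\right|_{r^is^j}\right).$$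
   Context: A Schröder path is a lattice path in $\mathbb Z^2$ with steps $(-1,0)$, $(0,1)$, $(-1,1)$; it is restricted if its last step is not $(0,1)$. A family is non-intersecting if no two paths share a vertex. Fix $n\ge1$ and consider pairs $(I,\mathcal P)$ with $I=\{i_1<\dots<i_\ell\}\subseteq\{0,\dots,n-1\}$ (possibly empty) and $\mathcal P$ a non-intersecting family of restricted Schröder paths, the $k$-th from $(i_k,0)$ to $(0,i_k+1)$ (these encode the quarter-turn symmetric domino tilings of the holey Aztec-like square $\mathcal A_n$). For a path $p$ from $(i,0)$ to $(0,j)$: if $j<n$ set $\ell_1(p)=\ell_2(p)=0$; if $j=n$, let $\ell_1(p)$ be the $x$-coordinate of the last point of $p$ with $y$-coordinate $\le n-1$, and $\ell_2(p)$ the $x$-coordinate of the first point of $p$ with $y$-coordinate equal to $n$. Set $\ell_m(\mathcal P)=\sum_{p\in\mathcal P}\ell_m(p)$, let $T^{(m)}_{4,k}(\mathcal A_n)$ be the number of pairs $(I,\mathcal P)$ with $\ell_m(\mathcal P)=k$, and $T^{(m)}_4(\mathcal A_n;\tau)=\sum_{k=0}^{n-1}\tau^kT^{(m)}_{4,k}(\mathcal A_n)$, for $m=1,2$. *)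

(* Defs.v *)
From HB Require Import structures.
From mathcomp Require Import all_boot all_order all_algebra.
From mathcomp Require Import boolp.

Set Implicit Arguments.
Unset Strict Implicit.
Unset Printing Implicit Defensive.

Import Order.TTheory GRing.Theory Num.Theory.
Local Open Scope ring_scope.

(* Univariate formal power series.  The coefficient function is wrapped in a
   record so that multiplication is the Cauchy product, not the pointwise
   product of functions. *)

Record fps (R : Type) := Fps { fps_coef : nat -> R }.

Section FpsRing.

Context {R : comNzRingType}.
Implicit Types f g h : fps R.

HB.instance Definition _ := [isNew for @fps_coef R].
HB.instance Definition _ := [Choice of fps R by <:].

Lemma fpsP f g : fps_coef f =1 fps_coef g <-> f = g.
Proof. by split=> [/funext e|->//]; apply: val_inj. Qed.

Definition fps_add f g := Fps (fun n => fps_coef f n + fps_coef g n).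
Definition fps_opp f := Fps (fun n => - fps_coef f n).
Definition fps_const (c : R) := Fps (fun n => if n == 0%N then c else 0).
Definition fps_mul f g :=
  Fps (fun n => \sum_(k < n.+1) fps_coef f k * fps_coef g (n - k)).
Definition fps_var : fps R := Fps (fun n => (n == 1%N)%:R).

Definition fps_trunc (n : nat) f : {poly R} := \poly_(k < n.+1) fps_coef f k.

Lemma coef_trunc n f k : (k <= n)%N -> (fps_trunc n f)`_k = fps_coef f k.
Proof. by move=> kn; rewrite coef_poly ltnS kn. Qed.

Lemma coef_mul_trunc n f g k : (k <= n)%N ->
  fps_coef (fps_mul f g) k = (fps_trunc n f * fps_trunc n g)`_k.
Proof.
move=> kn; rewrite coefM; apply: eq_bigr => -[j /= jk] _.
by rewrite !coef_trunc // (leq_trans _ kn) ?leq_subr // -ltnS.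
Qed.

Fact fps_addA : associative fps_add.
Proof. by move=> f g h; apply/fpsP => n /=; rewrite addrA. Qed.

Fact fps_addC : commutative fps_add.
Proof. by move=> f g; apply/fpsP => n /=; rewrite addrC. Qed.

Fact fps_add0 : left_id (fps_const 0) fps_add.
Proof. by move=> f; apply/fpsP => n /=; rewrite if_same add0r. Qed.

Fact fps_addN : left_inverse (fps_const 0) fps_opp fps_add.
Proof. by move=> f; apply/fpsP => n /=; rewrite if_same addNr. Qed.

Fact fps_mulC : commutative fps_mul.
Proof.
by move=> f g; apply/fpsP => n; rewrite !(@coef_mul_trunc n) // mulrC.
Qed.

Fact fps_mulA : associative fps_mul.
Proof.
move=> f g h; apply/fpsP => n; rewrite !(@coef_mul_trunc n) //.
transitivity (fps_trunc n f * fps_trunc n g * fps_trunc n h)`_n.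
  rewrite -mulrA !coefM; apply: eq_bigr => k _; congr (_ * _).
  by rewrite coef_trunc ?leq_subr // (@coef_mul_trunc n) ?leq_subr.
rewrite !coefM; apply: eq_bigr => -[k kn] _ /=; congr (_ * _).
by rewrite coef_trunc // (@coef_mul_trunc n).
Qed.

Fact fps_mul1 : left_id (fps_const 1) fps_mul.
Proof.
move=> f; apply/fpsP => n /=.
by rewrite big_ord_recl /= mul1r subn0 big1 ?addr0 // => i _; rewrite mul0r.
Qed.

Fact fps_mulDl : left_distributive fps_mul fps_add.
Proof.
move=> f g h; apply/fpsP => n /=.
by rewrite -big_split; apply: eq_bigr => k _; rewrite mulrDl.
Qed.

Fact fps_oner_neq0 : fps_const 1 != fps_const 0.
Proof. by apply/eqP => /fpsP /(_ 0%N) /eqP; rewrite /= oner_eq0. Qed.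

HB.instance Definition _ :=
  GRing.isZmodule.Build (fps R) fps_addA fps_addC fps_add0 fps_addN.
HB.instance Definition _ := GRing.Zmodule_isComNzRing.Build (fps R)
  fps_mulA fps_mulC fps_mul1 fps_mulDl fps_oner_neq0.

End FpsRing.

Section FpsUnit.

Context {R : comUnitRingType}.
Implicit Types f g : fps R.

(* The first n.+1 coefficients of 1 / f, obtained by solving f * g = 1 degree by
   degree. *)
Fixpoint fps_inv_seq f (n : nat) : seq R :=
  if n is m.+1 then
    let t := fps_inv_seq f m in
    rcons t (- (fps_coef f 0)^-1 * \sum_(k < m.+1) fps_coef f (m.+1 - k) * t`_k)
  else [:: (fps_coef f 0)^-1].

Definition fps_unit : {pred fps R} := fun f => fps_coef f 0 \is a GRing.unit.

Definition fps_inv f : fps R :=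
  if f \in fps_unit then Fps (fun n => (fps_inv_seq f n)`_n) else f.

Lemma size_fps_inv_seq f n : size (fps_inv_seq f n) = n.+1.
Proof. by elim: n => //= n IHn; rewrite size_rcons IHn. Qed.

Lemma nth_fps_inv_seq f n k : (k <= n)%N ->
  (fps_inv_seq f n)`_k = (fps_inv_seq f k)`_k.
Proof.
elim: n => [|n IHn]; first by rewrite leqn0 => /eqP ->.
rewrite leq_eqVlt => /predU1P[-> //|kn].
by rewrite [in LHS]/= nth_rcons size_fps_inv_seq kn IHn.
Qed.

Fact fps_mulVx : {in fps_unit, left_inverse 1 fps_inv *%R}.
Proof.
move=> f fU; rewrite mulrC /fps_inv fU; apply/fpsP => -[|n] /=.
  by rewrite big_ord1 divrr.
rewrite big_ord_recl /= subn0 nth_rcons size_fps_inv_seq ltnn eqxx.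
rewrite mulrA mulrN divrr // mulN1r.
rewrite (reindex_inj rev_ord_inj) /= addrC; apply/eqP; rewrite subr_eq0.
apply/eqP; apply: eq_bigr => k _; have kn : (k <= n)%N by rewrite -ltnS.
rewrite /bump add1n !subSS (nth_fps_inv_seq _ (leq_subr k n)).
by rewrite subSn ?leq_subr // subKn.
Qed.

Fact fps_unitPl f g : g * f = 1 -> f \in fps_unit.
Proof.
move/fpsP/(_ 0%N); rewrite /= big_ord1 /= => gf1.
by apply/unitrPr; exists (fps_coef g 0); rewrite mulrC.
Qed.

Fact fps_inv_out : {in [predC fps_unit], fps_inv =1 id}.
Proof. by move=> f; rewrite inE /= /fps_inv => /negbTE ->. Qed.

HB.instance Definition _ := GRing.ComNzRing_hasMulInverse.Build (fps R)
  fps_mulVx fps_unitPl fps_inv_out.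

Lemma fps_unitE f : (f \is a GRing.unit) = (fps_coef f 0 \is a GRing.unit).
Proof. by []. Qed.

End FpsUnit.

(* Power series in r and s over Z[tau], as Z[tau][[s]][[r]]; the indeterminate
   tau is 'X. *)

Definition fps2 : comUnitRingType := fps (fps {poly int}).

Definition fps2_r : fps2 := fps_var.
Definition fps2_s : fps2 := fps_const fps_var.
Definition fps2_tau : fps2 := fps_const (fps_const 'X).

Definition coef_rs (f : fps2) (i j : nat) : {poly int} :=
  fps_coef (fps_coef f i) j.

(* Lattice paths, given by their starting point and their sequence of steps. *)

Definition schroder_steps : seq (int * int) := [:: (-1, 0); (0, 1); (-1, 1)].
Definition step := seq_sub schroder_steps.

Definition vertices (v : int * int) (p : seq step) : seq (int * int) :=
  v :: scanl (fun u (e : step) => u + ssval e) v p.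

Definition start (i : nat) : int * int := (i%:Z, 0).

Definition schroder_path (i j : nat) (p : seq step) : bool :=
  last (start i) (vertices (start i) p) == (0, j%:Z).

Definition restricted (p : seq step) : bool :=
  last (0, 0) [seq ssval e | e <- p] != (0, 1).

Lemma schroder_path_size i j p : schroder_path i j p -> (size p <= i + j)%N.
Proof.
have gain v : (v.2 - v.1 + (size p)%:Z <=
    (last v (vertices v p)).2 - (last v (vertices v p)).1)%R.
  rewrite /vertices [last _ _]/=.
  elim: p v => [|e p IHp] v /=; first by rewrite addr0.
  apply: le_trans (IHp _); rewrite intS addrA lerD2r /= opprD addrACA lerD2l.
  by case: e => -[a b] /=; rewrite !inE => /or3P[] /eqP[-> ->].
move=> /eqP e; move: (gain (start i)); rewrite e /= sub0r subr0.
by rewrite addrC lerBlDr -PoszD lez_nat addnC.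
Qed.

(* Values of l_1 and l_2 on a path from (i, 0) to (0, j), where j <= n. *)

Definition ell1 (n i j : nat) (p : seq step) : int :=
  if j == n
  then (last (start i) [seq v <- vertices (start i) p | v.2 <= n%:Z - 1]).1
  else 0.

Definition ell2 (n i j : nat) (p : seq step) : int :=
  if j == n
  then (head (start i) [seq v <- vertices (start i) p | v.2 == n%:Z]).1
  else 0.

Section Families.

Variable n : nat.

(* A path from (k, 0) to (0, k + 1) with k < n has at most 2n steps, by
   schroder_path_size, so the bound on the length discards no path. *)
Definition bounded_path := {bseq n.*2 of step}.

(* A pair (I, P); the path starting at (k, 0) is P k for k in I, and P k is set
   to [::] for k outside I so that each family is counted once. *)
Definition family : finType := ({set 'I_n} * {ffun 'I_n -> bounded_path})%type.

Definition nonintersecting (F : family) : bool :=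
  [forall k in F.1, forall l in F.1, (k != l) ==>
    ~~ has (mem (vertices (start k) (F.2 k))) (vertices (start l) (F.2 l))].

Definition schroder_family (F : family) : bool :=
  [&& [forall k, (k \notin F.1) ==> (F.2 k == [::] :> seq step)],
      [forall k in F.1, schroder_path k k.+1 (F.2 k) && restricted (F.2 k)]
    & nonintersecting F].

Variable ell : nat -> nat -> nat -> seq step -> int.

Definition ell_family (F : family) : int :=
  \sum_(k in F.1) ell n k k.+1 (F.2 k).

Definition T4_count (m : nat) : nat :=
  #|[set F : family | schroder_family F && (ell_family F == m%:Z)]|.

Definition T4 : {poly int} := \sum_(m < n) (T4_count m)%:R * 'X^m.

End Families.

(* Main.v *)
Require Import Defs.
From mathcomp Require Import all_boot all_order all_algebra all_fingroup.
From mathcomp Require Import zify ring.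

Set Implicit Arguments.
Unset Strict Implicit.
Unset Printing Implicit Defensive.

Import Order.TTheory GRing.Theory Num.Theory.
Local Open Scope ring_scope.

(* Both statistics are multiplicative: tau^ell is a product of step weights, tau
   for a horizontal step at height n and delta for a diagonal step up to height
   n, with delta = tau for ell_1 and delta = 1 for ell_2.  Each matrix of the
   statement is 1 + H, where H i j is the generating function of the weighted
   restricted paths from (i, 0) to (0, j + 1), so its determinant is the sum of
   the principal minors of H.

   That such a minor counts non-intersecting families is proved without a
   sign-reversing involution, by letting the starting points move.  Among the
   starting points with maximal x, take the one of smallest index: no other path
   can visit it.  Replacing it by its three successors expands both the
   determinant, by linearity in its row, and the generating function of the
   families; if a successor meets another starting point, the determinant has
   two equal rows and no family is non-intersecting.  When all starting points
   have reached x = 0, both sides are 1 if every point is at its target, and 0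
   otherwise. *)

(** * Power series in r and s *)

Lemma fps_coef_varM {R : comNzRingType} (f : fps R) (x : nat) :
  fps_coef (fps_var * f) x = if x is y.+1 then fps_coef f y else 0.
Proof.
rewrite /= big_ord_recl mul0r add0r; case: x => [|x]; first by rewrite big_ord0.
rewrite big_ord_recl /= mul1r subSS subn0 big1 ?addr0 // => i _.
by rewrite mul0r.
Qed.

Lemma fps_coef_constM {R : comNzRingType} (c : R) (f : fps R) (x : nat) :
  fps_coef (fps_const c * f) x = c * fps_coef f x.
Proof.
by rewrite /= big_ord_recl subn0 big1 ?addr0 // => i _; rewrite mul0r.
Qed.

Lemma fps_constD {R : comNzRingType} (a b : R) :
  fps_const (a + b) = fps_const a + fps_const b.
Proof. by apply/fpsP => -[|n] //=; rewrite addr0. Qed.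

Lemma fps_coefD {R : comNzRingType} (f g : fps R) (x : nat) :
  fps_coef (f + g) x = fps_coef f x + fps_coef g x.
Proof. by []. Qed.

Lemma fps_coefB {R : comNzRingType} (f g : fps R) (x : nat) :
  fps_coef (f - g) x = fps_coef f x - fps_coef g x.
Proof. by []. Qed.

Lemma fps_coef0 {R : comNzRingType} (x : nat) : fps_coef (0 : fps R) x = 0.
Proof. exact: if_same. Qed.

Lemma fps_coef1 {R : comNzRingType} (x : nat) :
  fps_coef (1 : fps R) x = (x == 0)%:R.
Proof. by case: x. Qed.

Lemma fps_unit_sub_var {R : comUnitRingType} (f : fps R) :
  1 - fps_var * f \is a GRing.unit.
Proof.
by rewrite fps_unitE fps_coefB fps_coef1 fps_coef_varM subr0 unitr1.
Qed.

Lemma divr_eq_mul {R : comUnitRingType} (a f g : R) :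
  g \is a GRing.unit -> g * f = a -> f = a / g.
Proof. by move=> gU <-; rewrite mulrC mulKr. Qed.

(** The geometric series as a fixed-point equation: a quotient can be unfolded once without any
    infinite sum. *)
Lemma divr_1subE {R : comUnitRingType} (a f : R) :
  1 - a \is a GRing.unit -> f / (1 - a) = f + a * (f / (1 - a)).
Proof.
move=> aU; apply/eqP; rewrite -subr_eq -{1}[f / _]mul1r -mulrBl mulrC.
by rewrite mulrVK.
Qed.

(** The outer variable of [fps2] is r; fixing the power of s first reduces each matrix column to one
    univariate series in r. *)
Definition s_coef (j : nat) (f : fps2) : fps {poly int} :=
  Fps (fun i => coef_rs f i j).

Lemma coef_s_coef j f i : fps_coef (s_coef j f) i = fps_coef (fps_coef f i) j.
Proof. by []. Qed.

Lemma s_coefB j f g : s_coef j (f - g) = s_coef j f - s_coef j g.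
Proof. by apply/fpsP. Qed.

Lemma s_coefD j f g : s_coef j (f + g) = s_coef j f + s_coef j g.
Proof. by apply/fpsP. Qed.

Lemma s_coef1 j : s_coef j 1 = (j == 0)%:R.
Proof. by apply/fpsP => -[|i]; case: j. Qed.

Lemma s_coef_rM j f : s_coef j (fps2_r * f) = fps_var * s_coef j f.
Proof.
apply/fpsP => -[|i]; rewrite coef_s_coef /fps2_r !fps_coef_varM //.
exact: fps_coef0.
Qed.

Lemma s_coef_tauM j f : s_coef j (fps2_tau * f) = fps_const 'X * s_coef j f.
Proof.
by apply/fpsP => i; rewrite coef_s_coef /fps2_tau !fps_coef_constM.
Qed.

Lemma s_coef_sM j f :
  s_coef j (fps2_s * f) = if j is k.+1 then s_coef k f else 0.
Proof.
apply/fpsP => i; rewrite coef_s_coef /fps2_s.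
by rewrite fps_coef_constM fps_coef_varM; case: j => //=; case: i.
Qed.

Lemma s_coef_sXM j k f :
  s_coef j (fps2_s ^+ k * f) = if (k <= j)%N then s_coef (j - k) f else 0.
Proof.
elim: k j => [|k IHk] j; first by rewrite mul1r subn0.
by rewrite exprS -mulrA s_coef_sM; case: j => [|j] //; rewrite IHk.
Qed.

Local Notation Pt := {poly int}.

Definition inv1r : fps Pt := (1 - fps_var)^-1.
Definition inv1tr (t : Pt) : fps Pt := (1 - fps_const t * fps_var)^-1.

Lemma unit1r {R : comUnitRingType} : 1 - (fps_var : fps R) \is a GRing.unit.
Proof. by rewrite -[X in _ - X]mulr1 fps_unit_sub_var. Qed.

Lemma s_coef_inv1r j f : s_coef j (f / (1 - fps2_r)) = s_coef j f * inv1r.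
Proof.
apply: divr_eq_mul; first exact: unit1r.
rewrite mulrBl mul1r -s_coef_rM -s_coefB; congr s_coef.
by apply/eqP; rewrite subr_eq -divr_1subE // unit1r.
Qed.

Lemma unit1tr : 1 - fps2_tau * fps2_r \is a GRing.unit.
Proof. by rewrite mulrC; apply: fps_unit_sub_var. Qed.

Lemma s_coef_inv1tr j f :
  s_coef j (f / (1 - fps2_tau * fps2_r)) = s_coef j f * inv1tr 'X.
Proof.
apply: divr_eq_mul; first by rewrite mulrC fps_unit_sub_var.
rewrite mulrBl mul1r -mulrA -s_coef_rM -s_coef_tauM -s_coefB; congr s_coef.
by apply/eqP; rewrite subr_eq mulrA -divr_1subE // unit1tr.
Qed.

Lemma s_coef_diagonal j : s_coef j (1 / (1 - fps2_r * fps2_s)) = fps_var ^+ j.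
Proof.
set f := 1 / _.
have fE : f = 1 + fps2_r * (fps2_s * f).
  by rewrite mulrA; apply: divr_1subE; apply: fps_unit_sub_var.
elim: j => [|j IHj]; rewrite fE s_coefD s_coef_rM s_coef_sM s_coef1.
  by rewrite mulr0 addr0.
by rewrite IHj add0r exprS.
Qed.

Lemma unit_schroder : 1 - fps2_r - fps2_s - fps2_r * fps2_s \is a GRing.unit.
Proof.
have -> : 1 - fps2_r - fps2_s - fps2_r * fps2_s =
  1 - fps2_s - fps2_r * (1 + fps2_s) by ring.
by rewrite fps_unitE fps_coefB fps_coef_varM subr0; exact: unit1r.
Qed.

(** The denominator is (1 - r) - s (1 + r), which gives a geometric series in s with ratio (1 + r) /
    (1 - r). *)
Lemma s_coef_schroder j :
  s_coef j (1 - fps2_r - fps2_s - fps2_r * fps2_s)^-1 =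
    (1 + fps_var) ^+ j * inv1r ^+ j.+1.
Proof.
move: unit_schroder; set D := _ - _ * _ => DU.
have DE :
  D^-1 = (1 + (fps2_s * D^-1 + fps2_r * (fps2_s * D^-1))) / (1 - fps2_r).
  apply: divr_eq_mul; first exact: unit1r.
  transitivity (D * D^-1 + (fps2_s * D^-1 + fps2_r * (fps2_s * D^-1))).
    by rewrite /D; ring.
  by rewrite divrr.
elim: j => [|j IHj].
  by rewrite DE s_coef_inv1r !s_coefD s_coef1 s_coef_rM !s_coef_sM mulr0 !addr0.
rewrite DE s_coef_inv1r !s_coefD s_coef1 s_coef_rM !s_coef_sM IHj /=.
by rewrite add0r !exprS; ring.
Qed.

(* Its r^i-coefficient is the total weight of the restricted paths from (i, 0)
   to (0, k) when a horizontal step at height k weighs [t], a diagonal step up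
   to height k weighs [d], and all other steps weigh 1. *)
Definition col_gf (t d : Pt) (k : nat) : fps Pt :=
  if k is k'.+1 then
    fps_const (t + d)
      * (fps_var * ((1 + fps_var) ^+ k' * inv1r ^+ k * inv1tr t))
  else inv1tr t.

Lemma inv1rE : inv1r = 1 + fps_var * inv1r.
Proof. by rewrite /inv1r -[_^-1]mul1r -divr_1subE // unit1r. Qed.

Lemma inv1trE t : inv1tr t = 1 + fps_const t * (fps_var * inv1tr t).
Proof.
rewrite mulrA /inv1tr -[_^-1]mul1r -divr_1subE //.
by rewrite mulrC fps_unit_sub_var.
Qed.

Lemma coef_col_gf0 t d k : fps_coef (col_gf t d k) 0 = (k == 0)%:R.
Proof.
case: k => [|k]; last by rewrite fps_coef_constM fps_coef_varM mulr0.
by rewrite /col_gf inv1trE fps_coefD fps_coef_constM fps_coef_varM mulr0 addr0.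
Qed.

Lemma coef_col_gfS0 t d x :
  fps_coef (col_gf t d 0) x.+1 = t * fps_coef (col_gf t d 0) x.
Proof.
rewrite /col_gf [in LHS]inv1trE fps_coefD fps_coef1 add0r.
by rewrite fps_coef_constM fps_coef_varM.
Qed.

(** The three terms come from a first step that is horizontal, vertical or diagonal. Here the
    diagonal step ends at the top height and so weighs [d]. *)
Lemma coef_col_gfS1 t d x :
  fps_coef (col_gf t d 1) x.+1 = fps_coef (col_gf t d 1) x
    + fps_coef (col_gf t d 0) x.+1 + d * fps_coef (col_gf t d 0) x.
Proof.
rewrite coef_col_gfS0 -addrA -mulrDl.
have {1}-> : col_gf t d 1 =
    fps_var * (col_gf t d 1) + fps_const (t + d) * (fps_var * col_gf t d 0).
  by rewrite /col_gf {1}inv1rE; ring.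
by rewrite fps_coefD fps_coef_constM !fps_coef_varM.
Qed.

Lemma coef_col_gfSS t d k x :
  fps_coef (col_gf t d k.+2) x.+1 = fps_coef (col_gf t d k.+2) x
    + fps_coef (col_gf t d k.+1) x.+1 + fps_coef (col_gf t d k.+1) x.
Proof.
have {1}-> : col_gf t d k.+2 =
    fps_var * (col_gf t d k.+2) + (col_gf t d k.+1 + fps_var * col_gf t d k.+1).
  by rewrite /col_gf exprS [inv1r ^+ k.+2]exprS {1}inv1rE; ring.
by rewrite !fps_coefD !fps_coef_varM addrA.
Qed.

(** * Identification of the matrices of the statement *)

Lemma fps_const1 {R : comNzRingType} : fps_const (1 : R) = 1.
Proof. by []. Qed.

Lemma inv1tr1 : inv1tr 1 = inv1r.
Proof. by rewrite /inv1tr mul1r. Qed.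

Lemma coef_var_exp (i j : nat) :
  fps_coef (fps_var ^+ j : fps Pt) i = (i == j)%:R.
Proof.
elim: j i => [|j IHj] i; first exact: fps_coef1.
by rewrite exprS fps_coef_varM; case: i.
Qed.

Lemma coef_rs_diagonalD i j f :
  coef_rs (1 / (1 - fps2_r * fps2_s) + f) i j =
    (i == j)%:R + fps_coef (s_coef j f) i.
Proof.
by rewrite -coef_var_exp -s_coef_diagonal -fps_coefD -s_coefD.
Qed.

(** With both special weights equal to tau, the factor t + d of [col_gf] is the 2 tau of the
    numerator; for ell_2 it is 1 + tau. *)
Lemma s_coef_weighted_ell1 j :
  s_coef j (2 * fps2_tau * fps2_r
    / ((1 - fps2_tau * fps2_r) * (1 - fps2_r - fps2_s - fps2_r * fps2_s)))
  = col_gf 'X 'X j.+1.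
Proof.
rewrite invrM ?unit1tr ?unit_schroder //.
set D := (X in X / _).
have -> : 2 * fps2_tau * fps2_r * (D / (1 - fps2_tau * fps2_r))
 = fps2_tau * (fps2_r * (D / (1 - fps2_tau * fps2_r))) +
   fps2_tau * (fps2_r * (D / (1 - fps2_tau * fps2_r))) by ring.
rewrite s_coefD s_coef_tauM s_coef_rM s_coef_inv1tr s_coef_schroder.
by rewrite /= fps_constD; ring.
Qed.

Lemma s_coef_weighted_ell2 j :
  s_coef j ((1 + fps2_tau) * fps2_r
    / ((1 - fps2_tau * fps2_r) * (1 - fps2_r - fps2_s - fps2_r * fps2_s)))
  = col_gf 'X 1 j.+1.
Proof.
rewrite invrM ?unit1tr ?unit_schroder //.
set D := (X in X / _).
have -> : (1 + fps2_tau) * fps2_r * (D / (1 - fps2_tau * fps2_r))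
 = fps2_r * (D / (1 - fps2_tau * fps2_r)) +
   fps2_tau * (fps2_r * (D / (1 - fps2_tau * fps2_r))) by ring.
rewrite s_coefD s_coef_tauM s_coef_rM s_coef_inv1tr s_coef_schroder.
by rewrite /= fps_constD fps_const1; ring.
Qed.

Lemma s_coef_unweighted j :
  s_coef j (2 * fps2_r
    / ((1 - fps2_r) * (1 - fps2_r - fps2_s - fps2_r * fps2_s)))
  = col_gf 1 1 j.+1.
Proof.
rewrite invrM ?unit1r ?unit_schroder //.
set D := (X in X / _).
have -> : 2 * fps2_r * (D / (1 - fps2_r))
 = fps2_r * (D / (1 - fps2_r)) + fps2_r * (D / (1 - fps2_r)) by ring.
rewrite s_coefD s_coef_rM s_coef_inv1r s_coef_schroder.
by rewrite /= inv1tr1 fps_constD fps_const1; ring.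
Qed.

Lemma s_coef_inv1rX j k f :
  s_coef j (f * (1 - fps2_r)^-1 ^+ k) = s_coef j f * inv1r ^+ k.
Proof.
elim: k f => [|k IHk] f; first by rewrite !mulr1.
by rewrite !exprS mulrA IHk s_coef_inv1r mulrA.
Qed.

Lemma s_coef_1rX j k f :
  s_coef j ((1 + fps2_r) ^+ k * f) = (1 + fps_var) ^+ k * s_coef j f.
Proof.
elim: k f => [|k IHk] f; first by rewrite !mul1r.
by rewrite !exprS -!mulrA mulrDl mul1r s_coefD s_coef_rM IHk; ring.
Qed.

Lemma s_coef_sXM_small n j f : (0 < n)%N -> (j < n)%N -> j != n.-1 ->
  s_coef j (fps2_s ^+ n.-1 * f) = 0.
Proof. by move=> ? ? ?; rewrite s_coef_sXM ifF //; lia. Qed.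

Lemma s_coef_sXM_last n f : s_coef n (fps2_s ^+ n * f) = s_coef 0 f.
Proof. by rewrite s_coef_sXM leqnn subnn. Qed.

Lemma s_coef0_numerator j :
  s_coef 0 ((1 + fps2_r) ^+ j / (1 - fps2_r) ^+ j.+1) =
    (1 + fps_var) ^+ j * inv1r ^+ j.+1.
Proof.
by rewrite s_coef_1rX -[_^-1]mul1r -exprVn s_coef_inv1rX s_coef1 mul1r.
Qed.

(** The weighted and the unweighted column share r (1 + r)^j / (1 - r)^(j+1); the bracket is the
    difference of their remaining factors. *)
Lemma s_coef_correction_ell1 j :
  s_coef j (fps2_s ^+ j * fps2_r
      * (2 * fps2_tau / (1 - fps2_tau * fps2_r) - 2 / (1 - fps2_r))
      * ((1 + fps2_r) ^+ j / (1 - fps2_r) ^+ j.+1))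
  = col_gf 'X 'X j.+1 - col_gf 1 1 j.+1.
Proof.
have := s_coef0_numerator j.
move: ((1 + fps2_r) ^+ j / (1 - fps2_r) ^+ j.+1) => Q Q0.
have Y0 := s_coef_inv1tr 0 Q; have Z0 := s_coef_inv1r 0 Q.
rewrite Q0 in Y0 Z0.
transitivity (s_coef 0 (
  (fps2_tau * (fps2_r * (Q / (1 - fps2_tau * fps2_r)))
   + fps2_tau * (fps2_r * (Q / (1 - fps2_tau * fps2_r)))) -
  (fps2_r * (Q / (1 - fps2_r)) + fps2_r * (Q / (1 - fps2_r))))).
  rewrite -(s_coef_sXM_last j); congr s_coef; ring.
move: (Q / (1 - fps2_r)) (Q / _) Y0 Z0 => Z Y Y0 Z0.
rewrite s_coefB (s_coefD _ (fps2_tau * (fps2_r * Y))) (s_coefD _ (fps2_r * Z)).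
rewrite ?s_coef_tauM (s_coef_rM 0 Y) (s_coef_rM 0 Z) Y0 Z0.
by rewrite /= inv1tr1 !fps_constD fps_const1; ring.
Qed.

Lemma s_coef_correction_ell2 j :
  s_coef j (fps2_s ^+ j * fps2_r
      * ((1 + fps2_tau) / (1 - fps2_tau * fps2_r) - 2 / (1 - fps2_r))
      * ((1 + fps2_r) ^+ j / (1 - fps2_r) ^+ j.+1))
  = col_gf 'X 1 j.+1 - col_gf 1 1 j.+1.
Proof.
have := s_coef0_numerator j.
move: ((1 + fps2_r) ^+ j / (1 - fps2_r) ^+ j.+1) => Q Q0.
have Y0 := s_coef_inv1tr 0 Q; have Z0 := s_coef_inv1r 0 Q.
rewrite Q0 in Y0 Z0.
transitivity (s_coef 0 (
  (fps2_r * (Q / (1 - fps2_tau * fps2_r))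
   + fps2_tau * (fps2_r * (Q / (1 - fps2_tau * fps2_r)))) -
  (fps2_r * (Q / (1 - fps2_r)) + fps2_r * (Q / (1 - fps2_r))))).
  rewrite -(s_coef_sXM_last j); congr s_coef; ring.
move: (Q / (1 - fps2_r)) (Q / _) Y0 Z0 => Z Y Y0 Z0.
rewrite s_coefB (s_coefD _ (fps2_r * Y)) (s_coefD _ (fps2_r * Z)).
rewrite ?s_coef_tauM (s_coef_rM 0 Y) (s_coef_rM 0 Z) Y0 Z0.
by rewrite /= inv1tr1 !fps_constD fps_const1; ring.
Qed.

(** [j] selects the weighting and [k] is the height still to climb: [k] drops as a starting point
    moves up, while the target stays fixed. *)
Definition col_entry (n : nat) (d : Pt) (j k : nat) : fps Pt :=
  if j == n.-1 then col_gf 'X d k else col_gf 1 1 k.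

Definition count_mx (n : nat) (d : Pt) : 'M[Pt]_n :=
  \matrix_(i < n, j < n) ((i == j)%:R + fps_coef (col_entry n d j j.+1) i).

Lemma mx_weighted_ell1 (n : nat) :
  let r := fps2_r in let s := fps2_s in let tau := fps2_tau in
  \matrix_(i < n, j < n)
          (if (j : nat) == n.-1
          then coef_rs (1 / (1 - r * s)
                 + 2 * tau * r / ((1 - tau * r) * (1 - r - s - r * s))) i j
          else coef_rs (1 / (1 - r * s)
                 + 2 * r / ((1 - r) * (1 - r - s - r * s))) i j)
  = count_mx n 'X.
Proof.
move=> r s tau; apply/matrixP => i j; rewrite !mxE /col_entry.
case: ifP => _; rewrite coef_rs_diagonalD.
  by rewrite s_coef_weighted_ell1.
by rewrite s_coef_unweighted.
Qed.

Lemma mx_weighted_ell2 (n : nat) :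
  let r := fps2_r in let s := fps2_s in let tau := fps2_tau in
  \matrix_(i < n, j < n)
          (if (j : nat) == n.-1
          then coef_rs (1 / (1 - r * s)
                 + (1 + tau) * r / ((1 - tau * r) * (1 - r - s - r * s))) i j
          else coef_rs (1 / (1 - r * s)
                 + 2 * r / ((1 - r) * (1 - r - s - r * s))) i j)
  = count_mx n 1.
Proof.
move=> r s tau; apply/matrixP => i j; rewrite !mxE /col_entry.
case: ifP => _; rewrite coef_rs_diagonalD.
  by rewrite s_coef_weighted_ell2.
by rewrite s_coef_unweighted.
Qed.

Lemma mx_corrected (n : nat) (d : Pt) (A : fps2) : (0 < n)%N ->
  let r := fps2_r in let s := fps2_s in let tau := fps2_tau in
  (forall j, s_coef j (s ^+ j * r * A * ((1 + r) ^+ j / (1 - r) ^+ j.+1))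
     = col_gf 'X d j.+1 - col_gf 1 1 j.+1) ->
  \matrix_(i < n, j < n)
          coef_rs (1 / (1 - r * s)
            + 2 * r / ((1 - r) * (1 - r - s - r * s))
            + s ^+ n.-1 * r * A
              * ((1 + r) ^+ n.-1 / (1 - r) ^+ n)) i j
  = count_mx n d.
Proof.
case: n => // n _ r s tau corr; apply/matrixP => i j; rewrite !mxE /col_entry.
rewrite -addrA coef_rs_diagonalD s_coefD s_coef_unweighted [n.+1.-1]/=.
congr (_ + fps_coef _ i).
case: (eqVneq (nat_of_ord j) n) => [->|jn]; first by rewrite corr addrC subrK.
by rewrite -!mulrA (@s_coef_sXM_small n.+1) // addr0.
Qed.

(** * Weighted paths *)

Lemma sum_step {M : nmodType} (F : int * int -> M) :
  \sum_(e : step) F (ssval e) = F (-1, 0) + F (0, 1) + F (-1, 1).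
Proof.
have enumE : [seq ssval e | e <- index_enum step] = schroder_steps.
  by rewrite [index_enum _]unlock unlock; exact: val_seq_sub_enum.
rewrite -(big_map (fun e : step => ssval e) xpredT F) enumE.
by rewrite !big_cons big_nil addr0 addrA.
Qed.

Lemma pairD (a b x y : int) : (a, b) + (x, y) = (a + x, b + y).
Proof. by []. Qed.

Lemma stepP (e : step) :
  [\/ ssval e = (-1, 0), ssval e = (0, 1) | ssval e = (-1, 1)].
Proof.
case: e => e /=; rewrite !inE => /or3P[] /eqP ->;
  [exact: Or31 | exact: Or32 | exact: Or33].
Qed.

Definition step_weight (n : nat) (d : Pt) (v e : int * int) : Pt :=
  if (e.1 != 0) && (v.2 + e.2 == n%:Z) then if e.2 == 0 then 'X else d else 1.

Fixpoint path_weight (n : nat) (d : Pt) (v : int * int) (p : seq step) : Pt :=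
  if p is e :: q then
    step_weight n d v (ssval e) * path_weight n d (v + ssval e) q
  else 1.

(* The last step of a path ending on x = 0 is not vertical exactly when the path
   stops as soon as it reaches that line. *)
Fixpoint restricted_path (j : nat) (v : int * int) (p : seq step) : bool :=
  if p is e :: q then (v.1 != 0) && restricted_path j (v + ssval e) q
  else v == (0, j%:Z).

(** Column [j] belongs to the target (0, j + 1). The test on [v.2] guards the absolute value, which
    would treat a point above the target like one below it. *)
Definition path_gf (n : nat) (d : Pt) (v : int * int) (j : nat) : Pt :=
  if v.2 <= j.+1%:Z
  then fps_coef (col_entry n d j `|j.+1%:Z - v.2|) `|v.1| else 0.

Lemma path_gf_step n d (v : int * int) (j : nat) :
  (j < n)%N -> 0 < v.1 -> v.2 <= n%:Z ->
  path_gf n d v j =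
    \sum_(e : step) step_weight n d v (ssval e) * path_gf n d (v + ssval e) j.
Proof.
move=> jn; case: v => -[[|x]|x] y //= _ yn.
rewrite (sum_step (fun e => step_weight n d (x.+1%:Z, y) e
           * path_gf n d ((x.+1%:Z, y) + e) j)).
have xE : x.+1%:Z + -1 = x%:Z by lia.
rewrite !pairD xE !addr0.
rewrite /path_gf /step_weight /= addr0 mul1r.
have [yj|yj] := leP y j.+1%:Z; last first.
  have -> : (y + 1 <= j.+1%:Z) = false by lia.
  by rewrite !mulr0 !addr0.
move k_def: (`|j.+1%:Z - y|)%N => k.
have -> : (y + 1 <= j.+1%:Z) = (0 < k)%N by lia.
(* As [j < n], height n is met only in the last column with nothing left to climb, so special
   weights arise only there. *)
have -> : (y == n%:Z) = (j == n.-1) && (k == 0)%N by lia.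
rewrite /col_entry; case: k k_def => [|k] k_def.
  rewrite andbT ltnn mulr0 !addr0.
  by case: ifP => _; rewrite coef_col_gfS0 ?mul1r.
have -> : (`|j.+1%:Z - (y + 1)%R|)%N = k by lia.
have -> : (y + 1 == n%:Z) = (j == n.-1) && (k == 0)%N by lia.
rewrite andbF ltn0Sn mul1r; case: (j == n.-1); case: k {k_def} => [|k].
- by rewrite coef_col_gfS1.
- by rewrite coef_col_gfSS andbF mul1r.
- by rewrite coef_col_gfS1.
- by rewrite coef_col_gfSS mul1r.
Qed.

Lemma path_gf_top n d (v : int * int) (j : nat) :
  j.+1%:Z < v.2 -> path_gf n d v j = 0.
Proof. by move=> vj; rewrite /path_gf leNgt vj. Qed.

Lemma path_gf_end n d (v : int * int) (j : nat) :
  v.1 = 0 -> path_gf n d v j = (v.2 == j.+1%:Z)%:R.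
Proof.
move=> v0; rewrite /path_gf v0; case: ifP => vj; last first.
  by have -> : (v.2 == j.+1%:Z) = false by lia.
have -> : (v.2 == j.+1%:Z) = (`|j.+1%:Z - v.2| == 0)%N by lia.
by rewrite /col_entry; case: ifP => _; rewrite coef_col_gf0.
Qed.

Lemma path_gf_start n d (i j : nat) :
  path_gf n d (start i) j = fps_coef (col_entry n d j j.+1) i.
Proof. by rewrite /path_gf [_ - _]subr0. Qed.

Lemma vertices_cons v e p : vertices v (e :: p) = v :: vertices (v + ssval e) p.
Proof. by []. Qed.

Lemma vertices_bound (u v : int * int) (p : seq step) :
  u \in vertices v p -> u.1 <= v.1 /\ v.2 <= u.2.
Proof.
elim: p v => [|e p IHp] v; first by rewrite inE => /eqP ->.
rewrite vertices_cons inE => /predU1P[-> //|/IHp] /=.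
by case: (stepP e) => -> /=; lia.
Qed.

Lemma end_vertices_bound (j : nat) (v : int * int) (p : seq step) :
  last v (vertices v p) = (0, j%:Z) -> 0 <= v.1 /\ v.2 <= j%:Z.
Proof.
move=> lastE; have := @vertices_bound (0, j%:Z) v p; apply.
by rewrite -lastE; exact: (mem_last v (scanl _ v p)).
Qed.

(** Leaving the axis would make x negative for good, so every step is vertical. The default (0, 1)
    covers the empty path. *)
Lemma last_step_on_axis (j : nat) (v : int * int) (p : seq step) : v.1 = 0 ->
  last v (vertices v p) = (0, j%:Z) ->
  last (0, 1) [seq ssval e | e <- p] = (0, 1).
Proof.
elim: p v => [|e p IHp] v v0 //= lastE.
have [w_ge0 _] := @end_vertices_bound j (v + ssval e) p lastE.
have := IHp (v + ssval e) _ lastE.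
case: (stepP e) w_ge0 => -> /=; rewrite v0; first by lia.
  by move=> _; apply; lia.
by lia.
Qed.

Lemma restricted_pathE j v p : restricted_path j v p =
  (last v (vertices v p) == (0, j%:Z)) && restricted p.
Proof.
elim: p v => [|e p IHp] v; first by rewrite /= andbT.
have -> : last v (vertices v (e :: p))
  = last (v + ssval e) (vertices (v + ssval e) p) by [].
rewrite [LHS]/= IHp; set w := v + ssval e.
have [/eqP lastE|] := boolP (last w (vertices w p) == _); last by rewrite andbF.
have [w_ge0 _] := end_vertices_bound lastE.
have [v0|v_neq0] /= := eqVneq v.1 0.
  have [w0 eE] : w.1 = 0 /\ ssval e = (0, 1).
    move: w_ge0; rewrite /w; case: (stepP e) => -> /=; rewrite v0; try lia.
    by split.
  by rewrite /restricted /= eE (last_step_on_axis w0 lastE) // eqxx.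
(* The two [restricted] conditions can differ only if [e] is the last step; a vertical [e] would
   then leave x nonzero at the end. *)
case: p lastE {IHp} => [|e' p] //= lastE.
apply/esym/negP; rewrite /restricted /= => /eqP eE.
by move: v_neq0 lastE; rewrite /w eE; case: (v) => a b /= + []; lia.
Qed.

Lemma restricted_path_size j v p :
  restricted_path j v p -> (size p)%:Z <= v.1 - v.2 + j%:Z.
Proof.
elim: p v => [|e p IHp] v /=; first by move=> /eqP -> /=; lia.
by move=> /andP[_ /IHp]; case: (stepP e) => -> /=; lia.
Qed.

Lemma restricted_path_le j v p :
  restricted_path j v p -> 0 <= v.1 /\ v.2 <= j%:Z.
Proof.
elim: p v => [|e p IHp] v /=; first by move=> /eqP -> /=.
by move=> /andP[_ /IHp]; case: (stepP e) => -> /=; lia.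
Qed.

(** * Path weights and the two statistics *)

Lemma path_weight_below n d j (v : int * int) p : (j < n)%N ->
  restricted_path j v p -> path_weight n d v p = 1.
Proof.
move=> jn; elim: p v => [|e p IHp] v //= /andP[_ pP].
rewrite IHp // mulr1 /step_weight ifF //.
by have [_] := restricted_path_le pP; rewrite /=; lia.
Qed.

(** At height n only horizontal steps remain, one for each unit of x, each weighing tau. *)
Lemma path_weight_top n d (v : int * int) p : v.2 = n%:Z ->
  restricted_path n v p -> path_weight n d v p = 'X^`|v.1|.
Proof.
elim: p v => [|e p IHp] v vn /=; first by move=> /eqP ->.
move=> /andP[v0 pP]; have [v1 v2] := restricted_path_le pP.
case: (stepP e) v1 v2 pP => eE; rewrite eE /= => v1 v2 pP; try lia.
rewrite IHp //=; last by lia.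
by rewrite /step_weight /= addr0 vn eqxx -exprS; congr ('X ^+ _); lia.
Qed.

Lemma last_vertices_below (j : int) (u v : int * int) (p : seq step) :
  j < v.2 ->
  last u [seq w <- vertices v p | w.2 <= j] = u.
Proof.
move=> jv; rewrite (_ : filter _ _ = [::]) //.
apply/eqP; rewrite -size_eq0 size_filter -leqn0 leqNgt -has_count -all_predC.
by apply/allP => w /vertices_bound /= [_ ?]; lia.
Qed.

(** From the last point below height n, at abscissa x, a vertical step leaves x horizontal steps of
    weight tau; a diagonal step leaves x - 1 of them and weighs tau itself. The default [u] is
    arbitrary so that the induction can hand over the current vertex. *)
Lemma path_weight_ell1 n (v u : int * int) p :
  v.2 < n%:Z -> restricted_path n v p ->
  path_weight n 'X v p =
    'X^`|(last u [seq w <- vertices v p | w.2 <= n%:Z - 1]).1|.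
Proof.
elim: p v u => [|e p IHp] v u vn.
  by move=> /= /eqP vE; move: vn; rewrite vE /= ltxx.
move=> /= /andP[v0 pP]; have [v1 v2] := restricted_path_le pP.
have -> : v.2 <= n%:Z - 1 by lia.
rewrite [last _ _]/=.
have [en|en] := ltP (v + ssval e).2 n%:Z.
  rewrite (IHp _ v) // /step_weight ifF ?mul1r //.
  by move: en => /=; lia.
have en1 : n%:Z - 1 < (v + ssval e).2.
  by rewrite ltrBlDr; apply: le_lt_trans en _; rewrite ltrDl.
rewrite last_vertices_below //.
rewrite path_weight_top //; last by apply/le_anti; rewrite v2 en.
case: (stepP e) v1 v2 en pP => eE; rewrite eE /= => v1 v2 en pP; first by lia.
  by rewrite /step_weight /= mul1r addr0.
rewrite /step_weight /= ifT; last by lia.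
by rewrite -exprS; congr ('X ^+ _); lia.
Qed.

(** A diagonal step up to height n weighs 1, so only the horizontal steps after the arrival there
    count, and x at the arrival is their number. *)
Lemma path_weight_ell2 n (v u : int * int) p :
  v.2 <= n%:Z -> restricted_path n v p ->
  path_weight n 1 v p =
    'X^`|(head u [seq w <- vertices v p | w.2 == n%:Z]).1|.
Proof.
elim: p v u => [|e p IHp] v u vn pP.
  by move: (pP) => /= /eqP ->; rewrite /= eqxx.
rewrite [filter _ _]/=; case: eqP => [vE|vE].
  by rewrite path_weight_top.
move: pP => /= /andP[v0 pP]; have [v1 v2] := restricted_path_le pP.
rewrite (IHp _ u) // /step_weight.
by case: (stepP e) => -> /=; case: ifP => //; rewrite ?mul1r //; lia.
Qed.

(** * Families of paths and determinants *)

Section FamilyDeterminant.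

Variables (n : nat) (d : Pt) (I : {set 'I_n}).
Implicit Types (v : 'I_n -> int * int) (P Q : {ffun 'I_n -> bounded_path n}).

Definition family_ok v P : bool :=
  [&& [forall k, (k \notin I) ==> (P k == [::] :> seq step)],
      [forall k in I, restricted_path k.+1 (v k) (P k)]
    & [forall k in I, forall l in I, (k != l) ==>
        ~~ has (mem (vertices (v k) (P k))) (vertices (v l) (P l))]].

Definition family_gf v : Pt :=
  \sum_(P | family_ok v P) \prod_(k in I) path_weight n d (v k) (P k).

(** Identity rows outside [I] express a principal minor as a determinant of full size, without
    reindexing a submatrix. *)
Definition family_mx v : 'M[Pt]_n :=
  \matrix_(i, j) (if i \in I then path_gf n d (v i) j else (i == j)%:R).

Definition advance v (m : 'I_n) (e : int * int) (k : 'I_n) : int * int :=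
  if k == m then v k + e else v k.

Lemma det_family_mx_advance v (m : 'I_n) : m \in I -> 0 < (v m).1 ->
  (v m).2 <= n%:Z ->
  \det (family_mx v) = \sum_(e : step)
    step_weight n d (v m) (ssval e) * \det (family_mx (advance v m (ssval e))).
Proof.
move=> mI xm ym; rewrite (expand_det_row _ m).
transitivity (\sum_(j < n) \sum_(e : step) step_weight n d (v m) (ssval e)
   * (family_mx (advance v m (ssval e)) m j
      * cofactor (family_mx (advance v m (ssval e))) m j)); last first.
  rewrite exchange_big; apply: eq_bigr => e _.
  by rewrite (expand_det_row _ m) mulr_sumr.
apply: eq_bigr => j _; rewrite mxE mI path_gf_step // mulr_suml.
apply: eq_bigr => e _; rewrite mxE mI /advance eqxx -mulrA; congr (_ * (_ * _)).
(* Cofactors along row [m] do not involve that row, the only one that [advance] changes. *)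
congr (_ * \det _); apply/matrixP => i k; rewrite !mxE.
by rewrite /advance (eq_sym _ m) (negbTE (neq_lift _ _)).
Qed.

Definition set_path P (m : 'I_n) (q : bounded_path n) :
  {ffun 'I_n -> bounded_path n} := [ffun k => if k == m then q else P k].

Lemma set_pathE P m q k : set_path P m q k = if k == m then q else P k.
Proof. by rewrite ffunE. Qed.

(** Along a path x never increases and y never decreases, so the comparison of [v k] with [v m]
    keeps [v m] off every other path; dropping this vertex from path [m] does not affect
    disjointness. *)
Lemma family_ok_advance v P Q (m : 'I_n) (e : step) (q : seq step) : m \in I ->
  0 < (v m).1 ->
  (forall k, k \in I -> k != m -> (v k).1 < (v m).1 \/ (v m).2 < (v k).2) ->
  P m = e :: q :> seq step -> Q m = q :> seq step ->
  (forall k, k != m -> P k = Q k) ->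
  family_ok v P = family_ok (advance v m (ssval e)) Q.
Proof.
move=> mI xm m_first Pm Qm PQ; rewrite /family_ok; congr [&& _, _ & _].
- apply: eq_forallb => k; have [->|km] := eqVneq k m; first by rewrite mI.
  by rewrite PQ.
- apply: eq_forallb => k; rewrite /advance; have [->|km] := eqVneq k m.
    by rewrite mI Pm Qm /= gt_eqF.
  by rewrite PQ.
have m_notin k : k \in I -> k != m -> v m \notin vertices (v k) (P k).
  move=> kI km; apply/negP => /vertices_bound.
  by case: (m_first _ kI km); lia.
apply: eq_forallb => k; have [kI|] := boolP (k \in I) => //; congr (_ ==> _).
apply: eq_forallb => l; have [lI|] := boolP (l \in I) => //; congr (_ ==> _).
have [//|kl] := eqVneq k l; congr (_ ==> ~~ _).
rewrite /advance; have [km|km] := eqVneq k m; have [lm|lm] := eqVneq l m.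
- by rewrite km lm eqxx in kl.
- rewrite km Pm Qm PQ // vertices_cons; apply: eq_in_has => u uP.
  rewrite -[LHS]/(u \in _) inE; case: eqP => // uE.
  by move: (m_notin l lI lm); rewrite -uE PQ // uP.
- by rewrite lm Pm Qm vertices_cons /= (negbTE (m_notin k kI km)) PQ.
- by rewrite !PQ.
Qed.

(** Splitting off the first step of path [m] is a bijection. The bound on x - y ensures that
    prefixing a step stays within the length allowed by [bounded_path]. *)
Lemma family_gf_advance v (m : 'I_n) : m \in I -> 0 < (v m).1 ->
  (forall k, k \in I -> k != m -> (v k).1 < (v m).1 \/ (v m).2 < (v k).2) ->
  (v m).1 - (v m).2 + m.+1%:Z <= n.*2%:Z ->
  family_gf v = \sum_(e : step)
    step_weight n d (v m) (ssval e) * family_gf (advance v m (ssval e)).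
Proof.
move=> mI xm m_first size_m.
under eq_bigr => e _ do rewrite /family_gf mulr_sumr.
rewrite pair_big_dep /=.
pose e0 : step := SeqSub (mem_head (-1, 0) [:: (0, 1); (-1, 1)]).
pose cut P : step * {ffun 'I_n -> bounded_path n} :=
  (head e0 (P m), set_path P m (insub_bseq _ (behead (P m)))).
pose glue (x : step * {ffun 'I_n -> bounded_path n}) :=
  set_path x.2 m (insub_bseq n.*2 (x.1 :: x.2 m)).
have insubE (s : seq step) : (size s <= n.*2)%N ->
    insub_bseq n.*2 s = s :> seq step.
  by move=> sn; rewrite /insub_bseq insubdK.
have cutE P : P m != [::] :> seq step -> exists e q,
  [/\ P m = e :: q :> seq step, (cut P).1 = e & (cut P).2 m = q :> seq step].
  case PmE : (P m : seq step) => [|e q] // _; exists e, q; split=> //.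
    by rewrite /cut PmE.
  rewrite set_pathE eqxx PmE insubE //=.
  by have := size_bseq (P m); rewrite PmE; apply: ltnW.
rewrite [RHS](reindex_onto cut glue) /=; last first.
  move=> [e P] /= /and3P[_ /forall_inP/(_ m mI) + _].
  rewrite /advance eqxx => /restricted_path_size eP.
  have sz : (size (e :: P m) <= n.*2)%N.
    rewrite /= -ltz_nat; apply: le_lt_trans eP _.
    by case: (stepP e) => -> /=; lia.
  rewrite /cut /glue /= set_pathE eqxx insubE //=; congr pair.
  apply/ffunP => k; rewrite !set_pathE; case: eqP => [->|] //.
  apply: val_inj => /=; rewrite insubE //=.
  exact: ltnW.
have ok_neq0 P : family_ok v P -> P m != [::] :> seq step.
  move=> /and3P[_ /forall_inP/(_ m mI) Pm _]; apply/eqP => P0.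
  by move: Pm; rewrite P0 /= => /eqP vE; rewrite vE in xm.
have n2_gt0 : (0 < n.*2)%N by case: (m) => k; lia.
apply: eq_big => P.
  (* An empty path at [m] is cut to the default step [e0] and glued back to a path of length one, so
     it is excluded on both sides. *)
  have [P0|/cutE[e [q [PE eE qE]]]] := eqVneq (P m : seq step) [::].
    have -> : family_ok v P = false.
      by apply/negP => /ok_neq0; rewrite P0.
    apply/esym/negP => /andP[_ /eqP/ffunP/(_ m)].
    rewrite /glue set_pathE eqxx => /(congr1 val) /=.
    rewrite P0 set_pathE eqxx insubE //=.
    by rewrite insubE.
  have -> : glue (cut P) == P.
    apply/eqP/ffunP => k; rewrite /glue set_pathE.
    have [->|km] := eqVneq k m; last by rewrite /cut /= set_pathE (negbTE km).
    apply: val_inj; rewrite eE qE; apply: etrans (esym PE); apply: insubE.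
    by rewrite -PE size_bseq.
  rewrite andbT -[head _ _]/((cut P).1) eE.
  apply: (@family_ok_advance v P _ m e q) => // k km.
  by rewrite set_pathE (negbTE km).
move=> /ok_neq0 /cutE[e [q [PE eE qE]]].
rewrite -[head _ _]/((cut P).1) eE (bigD1 m) //= [in RHS](bigD1 m) //=.
rewrite mulrA; congr (_ * _).
  by rewrite -[set_path _ _ _]/((cut P).2) PE qE /advance eqxx.
apply: eq_bigr => k /andP[_ km].
by rewrite /advance set_pathE (negbTE km).
Qed.

End FamilyDeterminant.

(** * Evaluation of the determinant for moving starting points *)

Lemma perm_increasing_id {n : nat} (I : {set 'I_n}) (s : {perm 'I_n}) :
  (forall i, i \notin I -> s i = i) ->
  (forall i k, i \in I -> k \in I -> (i < k)%N -> (s i < s k)%N) ->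
  s = 1%g.
Proof.
move=> s_out s_incr; apply/permP => i; rewrite perm1.
have [m] := ubnP (i : nat); elim: m i => // m IHm i im.
have [iI|/s_out //] := boolP (i \in I).
(* The preimage of [i] is not smaller, since smaller indices are fixed. If it is larger, then [s i]
   is below [i], hence fixed, and injectivity gives [s i = i]. *)
set k := (s^-1)%g i; have sk : s k = i by rewrite permKV.
have [ki|ik|/val_inj ki] := ltngtP k i; last by rewrite -[RHS]sk ki.
  have : s k = k by apply: IHm; lia.
  by rewrite sk => ik; rewrite -ik ltnn in ki.
have kI : k \in I.
  by apply: contraT => /s_out; rewrite sk => ki; rewrite -ki ltnn in ik.
have si_lt := s_incr _ _ iI kI ik; rewrite sk in si_lt.
by apply: (@perm_inj _ s); apply: IHm; lia.
Qed.

Section LindstromGesselViennot.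

Variables (n : nat) (d : Pt) (I : {set 'I_n}).
Implicit Types (v : 'I_n -> int * int) (P : {ffun 'I_n -> bounded_path n}).

(* This invariant forces the paths to reach x = 0 in their initial order, which
   rules out every permutation but the identity. *)
Definition increasing_starts v : Prop := forall i k, i \in I -> k \in I ->
  (i < k)%N -> [/\ (v i).1 <= (v k).1, (v i).2 <= (v k).2 & v i <> v k].

Lemma det_family_mx_end v : increasing_starts v ->
  (forall k, k \in I -> (v k).1 = 0) ->
  \det (family_mx d I v) = [forall k in I, v k == (0, k.+1%:Z)]%:R.
Proof.
move=> v_incr x0.
have mxE0 i j : family_mx d I v i j =
    (if i \in I then (v i).2 == j.+1%:Z else i == j)%:R.
  by rewrite mxE; case: ifP => // iI; rewrite path_gf_end ?x0.
have [/forall_inP vE|not_end] := boolP [forall k in I, v k == (0, k.+1%:Z)].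
  rewrite -[RHS](det1 _ n); congr (\det _); apply/matrixP => i j.
  rewrite mxE0 mxE; case: ifP => // iI; rewrite (eqP (vE i iI)) /=.
  by congr (_%:R); apply/idP/idP => [/eqP|/eqP ->] //; lia.
(* In a nonzero Leibniz term, [v i] sits at the target of index [s i] for each [i] in [I]. The
   invariant makes [s] increasing on [I], hence the identity, so all points are at their own
   targets. *)
rewrite [\det _]big1 // => s _; apply/eqP; rewrite mulf_eq0; apply/orP; right.
apply: contraNT not_end => /prodf_neq0 s_nz.
have sE i : if i \in I then (v i).2 == (s i).+1%:Z else i == s i.
  have nz_true (b : bool) : b%:R != 0 :> Pt -> b by case: b; rewrite ?eqxx.
  by have := s_nz i isT; rewrite mxE0; case: ifP => _; apply: nz_true.
have s1 : s = 1%g.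
  apply: (@perm_increasing_id _ I) => [i iI|i k iI kI ik].
    by have := sE i; rewrite (negbTE iI) => /eqP.
  have [_ yik v_neq] := v_incr i k iI kI ik.
  have := sE i; have := sE k; rewrite iI kI => /eqP yk /eqP yi.
  have : (s i : nat) != s k.
    apply/eqP => sik; apply: v_neq.
    by apply: injective_projections; rewrite ?x0 // yi yk sik.
  by move: yik; rewrite yi yk; lia.
apply/forall_inP => i iI; have := sE i; rewrite iI s1 perm1 => /eqP yi.
by apply/eqP/injective_projections; rewrite ?x0.
Qed.

Lemma family_gf_end v : increasing_starts v ->
  (forall k, k \in I -> (v k).1 = 0) ->
  family_gf d I v = [forall k in I, v k == (0, k.+1%:Z)]%:R.
Proof.
move=> v_incr x0.
have ok_end P : family_ok I v P =
    [forall k in I, v k == (0, k.+1%:Z)] && (P == [ffun => [bseq]]).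
  apply/idP/idP => [/and3P[/forall_inP P0 /forall_inP vP _]
                   |/andP[/forall_inP vE /eqP ->]].
    have vP0 k : k \in I -> v k == (0, k.+1%:Z) /\ P k = [::] :> seq step.
      move=> kI; have := vP k kI; case: (P k : seq step) => //= e q.
      by rewrite x0 // eqxx.
    apply/andP; split; first by apply/forall_inP => k /vP0[].
    apply/eqP/ffunP => k; rewrite ffunE; apply: val_inj => /=.
    have [/vP0[]//|kI] := boolP (k \in I).
    exact/eqP/P0.
  apply/and3P; split.
  - by apply/forall_inP => k _; rewrite ffunE.
  - by apply/forall_inP => k kI; rewrite ffunE /= vE.
  apply/forall_inP => k kI; apply/forall_inP => l lI; apply/implyP => kl.
  rewrite !ffunE /= orbF inE (eqP (vE k kI)) (eqP (vE l lI)).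
  by apply: contra kl => /eqP[] lk; apply/eqP/val_inj.
rewrite /family_gf.
have [vE|vE] := boolP [forall k in I, v k == (0, k.+1%:Z)]; last first.
  by apply: big_pred0 => P; rewrite ok_end (negbTE vE).
rewrite (big_pred1 [ffun => [bseq]]) => [|P]; last by rewrite ok_end vE.
by rewrite big1 // => k _; rewrite ffunE.
Qed.

Lemma det_family_mx v : increasing_starts v ->
  (forall k, k \in I -> 0 <= (v k).1) ->
  (forall k, k \in I -> (v k).1 - (v k).2 + k.+1%:Z <= n.*2%:Z) ->
  \det (family_mx d I v) = family_gf d I v.
Proof.
(* Every step lowers x or raises y; the offset n + 1 keeps the measure decreasing even for a step
   from height n to n + 1. *)
have [c] := ubnP (\sum_(k in I) (`|(v k).1| + `|n.+1%:Z - (v k).2|))%N.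
elim: c v => // c IHc v /ltnSE v_c v_incr x_ge0 size_v.
(* From above height n no target can be reached: row [k] vanishes and no family exists. *)
have [/existsP[k /andP[kI yk]]|/existsPn y_le] :=
    boolP [exists k in I, n%:Z < (v k).2].
  have kn : k.+1%:Z <= n%:Z by have := ltn_ord k; lia.
  rewrite /family_gf big1; last first.
    move=> P /and3P[_ /forall_inP/(_ k kI) + _].
    by case/restricted_path_le; lia.
  rewrite (expand_det_row _ k) big1 // => j _.
  rewrite mxE kI path_gf_top ?mul0r //.
  by have := ltn_ord j; lia.
have {}y_le k : k \in I -> (v k).2 <= n%:Z.
  by move=> kI; have := y_le k; rewrite kI /= -leNgt.
have [/existsP[k /andP[kI xk]]|/existsPn x0] :=
    boolP [exists k in I, 0 < (v k).1]; last first.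
  have {}x0 k : k \in I -> (v k).1 = 0.
    move=> kI; apply/le_anti; rewrite x_ge0 // andbT.
    by have := x0 k; rewrite kI /= -leNgt.
  by rewrite det_family_mx_end ?family_gf_end.
have [m [mI xm m_first]] : exists m, [/\ m \in I, 0 < (v m).1 &
   forall i, i \in I -> i != m ->
     ((i < m)%N /\ (v i).1 < (v m).1) \/
     [/\ (m < i)%N, (v m).1 <= (v i).1 & (v m).1 = (v i).1 ]].
  have [M MI M_max] := @arg_maxnP _ k (mem I) (fun i => `|(v i).1|%N) kI.
  have MP : (M \in I) && ((v M).1 == (v M).1) by rewrite eqxx andbT.
  have [m /andP[mI /eqP mM] m_min] :=
    @arg_minnP _ M (fun i => (i \in I) && ((v i).1 == (v M).1))
      (@nat_of_ord n) MP.
  exists m; split=> // [|i iI im].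
    by have := M_max k kI; have := x_ge0 M MI; rewrite mM; lia.
  have i_le : (v i).1 <= (v m).1.
    have := M_max i iI; have := x_ge0 i iI; have := x_ge0 M MI.
    by rewrite mM /=; lia.
  have [mi|im'] := leqP m i.
    have mi' : (m < i)%N by rewrite ltn_neqAle mi andbT eq_sym.
    have [xmi _ _] := v_incr m i mI iI mi'.
    by right; split=> //; apply/le_anti; rewrite xmi.
  left; split=> //; rewrite lt_neqAle i_le andbT; apply/eqP => xE.
  by have := m_min i; rewrite iI xE mM eqxx => /(_ isT); rewrite leqNgt im'.
(* At equal x the index is larger, and the invariant then forces a strictly larger y. *)
have m_first' i : i \in I -> i != m -> (v i).1 < (v m).1 \/ (v m).2 < (v i).2.
  move=> iI im; case: (m_first i iI im) => [[_ ?]|[mi _ xE]]; [by left|right].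
  have [_ y_le' v_neq] := v_incr m i mI iI mi.
  rewrite lt_neqAle y_le' andbT; apply/eqP => yE; apply: v_neq.
  exact: injective_projections.
rewrite (det_family_mx_advance d mI) ?y_le // (family_gf_advance _ mI) ?size_v //.
apply: eq_bigr => e _; congr (_ * _).
set w := advance v m (ssval e).
have wm : w m = v m + ssval e by rewrite /w /advance eqxx.
have wk k0 : k0 != m -> w k0 = v k0 by rewrite /w /advance => /negbTE ->.
have [/existsP[l /and3P[lI lm /eqP wE]]|/existsPn no_collision] :=
    boolP [exists l in I, (l != m) && (w l == w m)].
  rewrite (determinant_alternate lm) => [|j]; last by rewrite !mxE lI mI wE.
  rewrite /family_gf big1 // => P /and3P[_ _ /forall_inP/(_ m mI)].
  move=> /forall_inP/(_ l lI)/implyP; rewrite eq_sym lm => /(_ isT).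
  by rewrite /= wE inE eqxx.
have w_neq l : l \in I -> l != m -> w l <> w m.
  by move=> lI lm /eqP wE; have := no_collision l; rewrite lI lm wE.
apply: IHc => [|i l iI lI il|l lI|l lI].
- apply: leq_trans v_c; rewrite (bigD1 m mI) [leqRHS](bigD1 m mI) /=.
  under eq_bigr => l /andP[_ lm] do rewrite wk //.
  rewrite ltn_add2r.
  have := y_le m mI; rewrite wm.
  by case: (stepP e) => -> /=; lia.
- have [x_le yl v_neq] := v_incr i l iI lI il.
  (* An index above [m] has the same x by maximality, hence a strictly larger y, which leaves room
     for a step up; an index below [m] has a strictly smaller x, which leaves room for a step to the
     left. *)
  have [im|im] := eqVneq i m; have [lm|lm] := eqVneq l m.
  + by move: il; rewrite im lm ltnn.
  + subst i; have {}w_neq := w_neq l lI lm; rewrite (wk l) //.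
    split; [| |by move=> /esym; rewrite -(wk l)].
    * by rewrite wm; case: (stepP e) => -> /=; lia.
    * case: (m_first l lI lm) => [[]|[_ _ xE]]; first by lia.
      case: (m_first' l lI lm); first by lia.
      by rewrite wm; case: (stepP e) => -> /=; lia.
  + subst l; have {}w_neq := w_neq i iI im; rewrite (wk i) //.
    split; [| |by rewrite -(wk i)].
    * case: (m_first i iI im) => [[_]|[]]; last by lia.
      by rewrite wm; case: (stepP e) => -> /=; lia.
    * by rewrite wm; case: (stepP e) => -> /=; lia.
  + by rewrite !wk.
- have [->|lm] := eqVneq l m; last by rewrite wk ?x_ge0.
  by rewrite wm; case: (stepP e) => -> /=; lia.
- have [->|lm] := eqVneq l m; last by rewrite wk ?size_v.
  by have := size_v m mI; rewrite wm; case: (stepP e) => -> /=; lia.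
Qed.

End LindstromGesselViennot.

(** * The statistics of a family *)

(** In each Leibniz product, every row offers the identity entry or the path entry; [I] is the set
    of rows where the path entry is chosen. *)
Lemma det_count_mx n d :
  \det (count_mx n d) = \sum_(I : {set 'I_n}) \det (family_mx d I start).
Proof.
rewrite [RHS]exchange_big; apply: eq_bigr => s _; rewrite -mulr_sumr.
congr (_ * _); under eq_bigr => i _ do rewrite mxE addrC -path_gf_start.
rewrite bigA_distr; apply: eq_bigr => I _; apply: eq_bigr => i _.
by rewrite mxE.
Qed.

Lemma det_family_mx_start n d (I : {set 'I_n}) :
  \det (family_mx d I start) = family_gf d I start.
Proof.
apply: det_family_mx => [i k _ _ ik| |k kI] //=.
  by split=> //=; [lia | case; lia].
by have := ltn_ord k; lia.
Qed.

Lemma schroder_familyE n (F : Defs.family n) :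
  schroder_family F = family_ok F.1 start F.2.
Proof.
rewrite /schroder_family /family_ok; congr [&& _, _ & _].
by apply: eq_forallb => k; rewrite restricted_pathE.
Qed.

Lemma restricted_path_vertex_ge0 j (u v : int * int) p :
  restricted_path j v p -> u \in vertices v p -> 0 <= u.1.
Proof.
elim: p v => [|e p IHp] v pP.
  by rewrite inE => /eqP ->; case: (restricted_path_le pP).
rewrite vertices_cons inE => /predU1P[->|].
  by case: (restricted_path_le pP).
by apply: IHp; case/andP: pP.
Qed.

(** All that the enumeration uses of a statistic; the bounds and the vanishing below height n
    confine the total of a family to 0, ..., n - 1. *)
Definition path_statistic n (d : Pt)
  (ell : nat -> nat -> nat -> seq step -> int) : Prop :=
  forall i p, (i < n)%N -> restricted_path i.+1 (start i) p ->
  [/\ 0 <= ell n i i.+1 p, ell n i i.+1 p <= i%:Z,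
      i.+1 != n -> ell n i i.+1 p = 0
    & path_weight n d (start i) p = 'X^`|ell n i i.+1 p|].

Lemma ell1_statistic n : path_statistic n 'X ell1.
Proof.
move=> i p i_lt pP; rewrite /ell1; case: eqP => [iE|/eqP i_neq]; last first.
  by split=> //; apply: path_weight_below pP; lia.
set f := filter _ _; have uP : last (start i) f \in vertices (start i) p.
  have := mem_last (start i) f; rewrite inE => /predU1P[->|].
    exact: mem_head.
  by rewrite mem_filter => /andP[].
split=> //; first exact: restricted_path_vertex_ge0 pP uP.
  by case: (vertices_bound uP).
by apply: path_weight_ell1; rewrite -iE //=; lia.
Qed.

Lemma ell2_statistic n : path_statistic n 1 ell2.
Proof.
move=> i p i_lt pP; rewrite /ell2; case: eqP => [iE|/eqP i_neq]; last first.
  by split=> //; apply: path_weight_below pP; lia.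
set f := filter _ _; have uP : head (start i) f \in vertices (start i) p.
  case fE : f => [|u f']; first exact: mem_head.
  have : u \in f by rewrite fE mem_head.
  by rewrite mem_filter => /andP[].
split=> //; first exact: restricted_path_vertex_ge0 pP uP.
  by case: (vertices_bound uP).
by apply: path_weight_ell2; rewrite -iE //=; lia.
Qed.

Lemma T4_countE n ell m : T4_count n ell m =
  (\sum_(F : Defs.family n |
      schroder_family F && (ell_family ell F == m%:Z)) 1)%N.
Proof. by rewrite sum1dep_card. Qed.

Lemma T4_det n d ell : (0 < n)%N -> path_statistic n d ell ->
  T4 n ell = \det (count_mx n d).
Proof.
move=> n_gt0 ellP; rewrite det_count_mx.
under [RHS]eq_bigr => I _ do rewrite det_family_mx_start /family_gf.
rewrite pair_big_dep /= /T4.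
transitivity (\sum_(m < n) \sum_(F : Defs.family n |
    schroder_family F && (ell_family ell F == (m : nat)%:Z)) 'X^m : Pt).
  apply: eq_bigr => m _; rewrite T4_countE natr_sum mulr_suml.
  by apply: eq_bigr => F _; rewrite mul1r.
rewrite (exchange_big_dep (fun F : Defs.family n => schroder_family F)) /=;
  last first.
  by move=> m F _ /andP[].
apply: eq_big => F; first exact: schroder_familyE.
move=> FP; have F_stat k : k \in F.1 ->
  [/\ 0 <= ell n k k.+1 (F.2 k), ell n k k.+1 (F.2 k) <= k%:Z,
      k.+1 != n -> ell n k k.+1 (F.2 k) = 0
    & path_weight n d (start k) (F.2 k) = 'X^`|ell n k k.+1 (F.2 k)|].
  move=> kF; apply: ellP => //.
  by move: FP; rewrite schroder_familyE => /and3P[_ /forall_inP/(_ k kF)].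
set a := (\sum_(k in F.1) `|ell n k k.+1 (F.2 k)|)%N.
have aE : ell_family ell F = a%:Z.
  rewrite /a (big_morph Posz PoszD (erefl _)); apply: eq_bigr => k kF.
  by case: (F_stat k kF) => ell_ge0 _ _ _; rewrite gez0_abs.
(* Only the path from (n - 1, 0) can contribute, by at most n - 1, so the truncation in [T4] loses
   no family. *)
have a_lt : (a < n)%N.
  case: n n_gt0 ellP F FP F_stat @a aE => // n' _ ellP F FP F_stat a _.
  pose top := `|ell n'.+1 n' n'.+1 (F.2 ord_max)|%N.
  rewrite ltnS; apply: (@leq_trans (top * (ord_max \in F.1))); last first.
    case: (boolP (_ \in _)) => [mF|]; rewrite ?muln0 ?muln1 //.
    by case: (F_stat ord_max mF) => /=; lia.
  rewrite /a big_mkcond (bigD1 ord_max) //= big1 ?addn0 => [|k km].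
    by case: ifP; rewrite ?muln0 ?muln1.
  case: ifP => // kF; case: (F_stat k kF) => _ _ -> //.
(* Each family is counted for exactly one exponent, its own total. *)
rewrite (big_pred1 (Ordinal a_lt)) => [|m] /=; last first.
  by rewrite [LHS]/(_ && _) FP aE eqz_nat eq_sym.
rewrite (big_morph _ (exprD 'X) (expr0 'X)).
by apply: eq_bigr => k kF; case: (F_stat k kF).
Qed.

Unset Implicit Arguments.

Theorem theorem4p2 (n : nat) (n_ge1 : (1 <= n)%N) :
  let r := fps2_r in
  let s := fps2_s in
  let tau := fps2_tau in
  [/\ T4 n ell1 =
        \det (\matrix_(i < n, j < n)
          if (j : nat) == n.-1
          then coef_rs (1 / (1 - r * s)
                 + 2 * tau * r / ((1 - tau * r) * (1 - r - s - r * s))) i j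
          else coef_rs (1 / (1 - r * s)
                 + 2 * r / ((1 - r) * (1 - r - s - r * s))) i j),
      T4 n ell1 =
        \det (\matrix_(i < n, j < n)
          coef_rs (1 / (1 - r * s)
            + 2 * r / ((1 - r) * (1 - r - s - r * s))
            + s ^+ n.-1 * r * (2 * tau / (1 - tau * r) - 2 / (1 - r))
              * ((1 + r) ^+ n.-1 / (1 - r) ^+ n)) i j),
      T4 n ell2 =
        \det (\matrix_(i < n, j < n)
          if (j : nat) == n.-1
          then coef_rs (1 / (1 - r * s)
                 + (1 + tau) * r / ((1 - tau * r) * (1 - r - s - r * s))) i j
          else coef_rs (1 / (1 - r * s)
                 + 2 * r / ((1 - r) * (1 - r - s - r * s))) i j)
    & T4 n ell2 =
        \det (\matrix_(i < n, j < n)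
          coef_rs (1 / (1 - r * s)
            + 2 * r / ((1 - r) * (1 - r - s - r * s))
            + s ^+ n.-1 * r * ((1 + tau) / (1 - tau * r) - 2 / (1 - r))
              * ((1 + r) ^+ n.-1 / (1 - r) ^+ n)) i j)].
Proof.
move=> r s tau; split.
- by rewrite mx_weighted_ell1; exact: T4_det n_ge1 (@ell1_statistic n).
- rewrite (mx_corrected n_ge1 s_coef_correction_ell1).
  exact: T4_det n_ge1 (@ell1_statistic n).
- by rewrite mx_weighted_ell2; exact: T4_det n_ge1 (@ell2_statistic n).
- rewrite (mx_corrected n_ge1 s_coef_correction_ell2).
  exact: T4_det n_ge1 (@ell2_statistic n).
Qed.
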